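(* Let $n\in\{1,2,\dots\}$ and let $K_{2n}$ be a complete network on $2n$ nodes (arcs may have different lengths) of total length $\mu$. For a 1-factorization $F=\{F_1,\dots,F_{2n-1}\}$ of $K_{2n}$ put $\delta(F)=\max_{1\le i\le 2n-1}\lambda(F_i)$, and let $F^*$ be a 1-factorization of $K_{2n}$ with $\delta^*:=\delta(F^* )\le\delta(F)$ for every 1-factorization $F$ of $K_{2n}$. If the attack duration satisfies $\alpha\le\mu-\delta^*$, then in the continuous patrolling game on $K_{2n}$ the complete network patrolling strategy $S^{F^*}$ (for the Patroller) and the uniform attack strategy (for the Attacker) are optimal, and the value of the game is $V=\alpha/\mu$.
   Context: **Networks.** A network $Q$ is a finite connected graph whose arcs are viewed as open intervals of positive finite length, with a node at each end of each arc. $\lambda$ denotes the length measure on $Q$ (nodes have measure $0$), $\mu=\lambda(Q)$, and $d(x,y)$ is the length of a shortest path between $x,y\in Q$. A complete network is one in which every pair of distinct nodes is joined by exactly one arc, with no loops. **Continuous patrolling game.** The parameter $\alpha$ satisfies $0<\alpha\le$ the minimum length of a closed walk covering $Q$. The Attacker chooses a point $x\in Q$ and a start time $t\ge 0$. The Patroller chooses a patrol, i.e. a path $S:[0,\infty)\to Q$ of speed at most one: $d(S(s),S(s'))\le |s-s'|$ for all $s,s'$. The attack is intercepted (payoff $1$ to the Patroller) if $x\in S([t,t+\alpha])$; otherwise the payoff is $0$. The game is zero-sum, the Patroller maximizes the interception probability and the Attacker minimizes it; both may use mixed strategies. The value $V$ is the common value of the sup (over mixed Patroller strategies) inf (over attacks)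 and the inf (over mixed Attacker strategies) sup (over patrols) of the interception probability. A Patroller strategy is optimal if it intercepts every attack with probability at least $V$; an Attacker strategy is optimal if every patrol intercepts it with probability at most $V$. **1-factorization.** A 1-factorization of $K_{2n}$ is a set $F=\{F_1,\dots,F_{2n-1}\}$ of perfect matchings (spanning 1-regular sub-networks) whose arc sets are pairwise disjoint and have union the whole arc set of $K_{2n}$. **Complete network patrolling strategy $S^F$.** For each $i$ let $Q_i=K_{2n}-F_i$ be the sub-network obtained by deleting the arcs of $F_i$ (all nodes are kept); $Q_i$ is $(2n-2)$-regular and hence Eulerian. Let $S_i$ be the randomized patrol that follows an Eulerian tour of $Q_i$ at unit speed, repeated periodically forever, starting at a uniformly random point of the tour. $S^F$ chooses $S_i$ with probability $s_i=\lambda(Q_i)/((2n-2)\mu)$, $i=1,\dots,2n-1$. (For $n=1$ the condition $\alpha\le\mu-\delta^*$ is never satisfied.) **Uniform attack strategy.** The attack begins at an arbitrary fixed time (e.g. time $0$) at a point of the network chosen uniformly at random with respect to $\lambda$. *)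

(* Defs.v *)
From HB Require Import structures.
From mathcomp Require Import all_boot all_order all_algebra.
From mathcomp Require Import all_classical all_reals all_analysis.
From mathcomp Require Import measurable_realfun ring lra.
Set Implicit Arguments.
Unset Strict Implicit.
Unset Printing Implicit Defensive.
Import Order.TTheory GRing.Theory Num.Theory.
Import numFieldNormedType.Exports.
Local Open Scope classical_set_scope.
Local Open Scope ring_scope.

Section finite_sum_of_measures.
Context d (T : measurableType d) (R : realType) (I : finType).
Variable m : I -> {measure set T -> \bar R}.
Local Open Scope ereal_scope.

Definition fin_msum (A : set T) : \bar R := \sum_(i : I) m i A.

Let fin_msum0 : fin_msum set0 = 0.
Proof. by rewrite /fin_msum big1. Qed.

Let fin_msum_ge0 B : 0 <= fin_msum B.
Proof. exact: sume_ge0. Qed.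

Let fin_msum_sigma_additive : semi_sigma_additive fin_msum.
Proof.
move=> F mF tF mUF; rewrite [X in _ --> X](_ : _ =
    lim ((fun n => \sum_(0 <= i < n) fin_msum (F i)) @ \oo)).
  by apply: is_cvg_ereal_nneg_natsum => k _; exact: sume_ge0.
rewrite nneseries_sum//; apply: eq_bigr => /= i _.
exact: measure_semi_bigcup.
Qed.

HB.instance Definition _ := isMeasure.Build _ _ _ fin_msum
  fin_msum0 fin_msum_ge0 fin_msum_sigma_additive.
End finite_sum_of_measures.

(* [pushforward] is a measure only up to a proof of measurability, which
   unification does not supply; carry the proof, as [mrestr] does. *)
Definition mpush d d' (T : measurableType d) (T' : measurableType d')
    (R : realType) (m : {measure set T -> \bar R}) (f : T -> T')
    (mf : measurable_fun [set: T] f) : set T' -> \bar R := pushforward m f.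

Section mpush_measure.
Context d d' (T : measurableType d) (T' : measurableType d') (R : realType).
Variables (m : {measure set T -> \bar R}) (f : T -> T').
Variable mf : measurable_fun [set: T] f.

Let mpush0 : mpush m mf set0 = 0%E.
Proof. by apply: measure0 => //. Qed.

Let mpush_ge0 A : (0 <= mpush m mf A)%E.
Proof. by apply: measure_ge0 => //. Qed.

Let mpush_sigma_additive : semi_sigma_additive (mpush m mf).
Proof. by apply: measure_semi_sigma_additive => //. Qed.

HB.instance Definition _ := isMeasure.Build _ _ _ (mpush m mf)
  mpush0 mpush_ge0 mpush_sigma_additive.
End mpush_measure.

(* [base_node] only witnesses that the network is nonempty.  Loops and parallel
   arcs are allowed; [src] and [tgt] fix an arbitrary orientation of each arc,
   used as a coordinate system on it. *)
Record network (R : realType) := Network {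
  net_node : finType;
  net_arc : finType;
  src : net_arc -> net_node;
  tgt : net_arc -> net_node;
  len : net_arc -> R;
  base_node : net_node;
  len_gt0 : forall a, 0 < len a;
  connectedP : forall u v,
    connect (fun x y => [exists a, ((src a, tgt a) == (x, y))
                               || ((src a, tgt a) == (y, x))]) u v }.
Arguments src {R Q} : rename.
Arguments tgt {R Q} : rename.
Arguments len {R Q} : rename.
Arguments base_node {R} Q : rename.
Arguments len_gt0 {R Q} : rename.

Section network.
Context {R : realType} (Q : network R).

Inductive net_point : Type :=
| Node of net_node Q
| Inner (a : net_arc Q) (t : R) of 0 < t < len a.

HB.instance Definition _ := gen_eqMixin net_point.
HB.instance Definition _ := gen_choiceMixin net_point.
HB.instance Definition _ := isPointed.Build net_point (Node (base_node Q)).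

(* The point of the closed arc [a] at distance [t] from its source along [a];
   [t] is clamped to [0, len a]. *)
Definition arc_point (a : net_arc Q) (t : R) : net_point :=
  match @idP (0 < t < len a) with
  | ReflectT h => Inner h
  | ReflectF _ => Node (if t <= 0 then src a else tgt a)
  end.

(* [path_length x y l]: some concatenation of segments of closed arcs goes
   from [x] to [y] and has total length [l]. *)
Inductive path_length : net_point -> net_point -> R -> Prop :=
| path_nil x : path_length x x 0
| path_cons a s t y l :
    0 <= s <= len a -> 0 <= t <= len a ->
    path_length (arc_point a t) y l ->
    path_length (arc_point a s) y (`|t - s| + l).

Definition dist (x y : net_point) : R := inf [set l | path_length x y l].

Definition net_open : set (set net_point) :=
  [set U | forall x, U x ->
     exists2 e : R, 0 < e & forall y, dist x y < e -> U y].

(* Borel sigma-algebra of [dist] *)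
HB.instance Definition _ := @isMeasurable.Build (sigma_display net_open)
  net_point <<s net_open >> (@sigma_algebra0 _ setT net_open)
  (@sigma_algebraC _ net_open) (@sigma_algebra_bigcup _ setT net_open).

Lemma path_length_ge0 x y l : path_length x y l -> 0 <= l.
Proof. by elim=> // *; rewrite addr_ge0. Qed.

Lemma path_lengthD x y z l m :
  path_length x y l -> path_length y z m -> path_length x z (l + m).
Proof.
move=> p; elim: p m => {x y l} [x m|a s t y l hs ht _ IH m pm].
  by rewrite add0r.
by rewrite -addrA; apply: path_cons => //; exact: IH.
Qed.

Lemma path_length_rev x y l : path_length x y l -> path_length y x l.
Proof.
elim=> {x y l} [x|a s t y l hs ht _ IH]; first exact: path_nil.
rewrite addrC; apply: (path_lengthD IH).
by rewrite distrC -[`|_|]addr0; apply: path_cons => //; exact: path_nil.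
Qed.

Lemma dist_le x y l : path_length x y l -> dist x y <= l.
Proof.
move=> p; apply: ge_inf => //=; exists 0 => m /=.
exact: path_length_ge0.
Qed.

Lemma arc_point_src (a : net_arc Q) (t : R) : t <= 0 -> arc_point a t = Node (src a).
Proof.
move=> t0; rewrite /arc_point; case: {-}_ / idP => [h|_]; last by rewrite t0.
by case/andP: (h); rewrite ltNge t0.
Qed.

Lemma arc_point_tgt (a : net_arc Q) (t : R) :
  len a <= t -> arc_point a t = Node (tgt a).
Proof.
move=> ht; rewrite /arc_point; case: {-}_ / idP => [h|_].
  by case/andP: (h) => _; rewrite ltNge ht.
by rewrite leNgt (lt_le_trans (len_gt0 a) ht).
Qed.

Lemma arc_point_clamp (a : net_arc Q) (t : R) :
  arc_point a t = arc_point a (Num.max 0 (Num.min t (len a))).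
Proof.
have l0 := ltW (len_gt0 a).
have [t0|t0] := leP t 0.
  rewrite !arc_point_src // ge_max lexx /=.
  by rewrite ge_min t0.
have [tl|tl] := leP t (len a).
  by rewrite max_r // ltW.
by rewrite max_r // (arc_point_tgt (ltW tl)) arc_point_tgt.
Qed.

Lemma arc_point_lip (a : net_arc Q) (s t : R) :
  dist (arc_point a s) (arc_point a t) <= `|s - t|.
Proof.
rewrite (arc_point_clamp a s) (arc_point_clamp a t).
have l0 := ltW (len_gt0 a).
have cl (u : R) : 0 <= Num.max 0 (Num.min u (len a)) <= len a.
  by rewrite le_max lexx /= ge_max l0 ge_min lexx orbT.
apply: le_trans (dist_le (path_cons (cl s) (cl t) (path_nil _))) _.
rewrite addr0 distrC.
wlog st : s t / s <= t.
  by move=> H; case/orP: (le_total s t) => /H //; rewrite distrC (distrC t).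
rewrite (distrC s t) (distrC (Num.max _ _)) !ger0_norm ?subr_ge0 //.
  rewrite /Num.max /Num.min; do 4!case: ifPn => //=;
  rewrite -?leNgt => *; lra.
rewrite ge_max le_max lexx /= le_max; apply/orP; right.
by rewrite le_min !ge_min st lexx orbT.
Qed.

Lemma lip_measurable (f : R -> net_point) :
  (forall s t, dist (f s) (f t) <= `|s - t|) -> measurable_fun setT f.
Proof.
move=> fl.
apply: (@measurability _ _ _ _ _ _ net_open) => //.
move=> _ [U oU <-]; rewrite setTI.
apply: open_measurable.
rewrite openE => x /= /oU[e e0 He].
exists e => //= y /= xy; apply: He.
exact: le_lt_trans (fl _ _) xy.
Qed.

Lemma arc_point_measurable (a : net_arc Q) : measurable_fun setT (arc_point a).
Proof. by apply: lip_measurable => s t; exact: arc_point_lip. Qed.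

(* Length measure: the sum over arcs of the images of Lebesgue measure on the
   open intervals, so that nodes are null. *)
Definition lambda : {measure set net_point -> \bar R} :=
  fin_msum (fun a : net_arc Q => mpush
    (mrestr (@lebesgue_measure R) (measurable_itv `]0, len a[))
    (arc_point_measurable a)).

Definition arcs_length (B : {set net_arc Q}) : R := \sum_(a in B) len a.
Definition total_length : R := arcs_length [set: net_arc Q]%SET.

Definition subnetwork (B : {set net_arc Q}) : set net_point :=
  [set x | if x is Inner a _ _ then a \in B else True].

Lemma lambda_subnetwork B : lambda (subnetwork B) = (arcs_length B)%:E.
Proof.
rewrite /arcs_length -sumEFin [RHS]big_mkcond /=.
apply: eq_bigr => a _; rewrite /mpush /pushforward /= /mrestr.
have sub (t : R) : 0 < t < len a ->
    subnetwork B (arc_point a t) = (a \in B) :> Prop.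
  by move=> h; rewrite /arc_point; case: {-}_ / idP.
case: ifPn => aB.
  rewrite (_ : _ `&` _ = [set` `]0, len a[]).
    by rewrite lebesgue_measure_itv /= lte_fin len_gt0 oppr0 adde0.
  apply/seteqP; split => [t []//|t /= ht]; split => //.
  by rewrite /preimage /= sub //; move: ht; rewrite in_itv.
rewrite (_ : _ `&` _ = set0) ?measure0 //.
apply/seteqP; split => // t [/= + ht]; rewrite sub ?(negPf aB) //.
Qed.

Lemma lambda_setT : lambda setT = total_length%:E.
Proof.
rewrite -lambda_subnetwork; congr (lambda _).
by apply/seteqP; split => // -[] //= a t _ _; rewrite inE.
Qed.

Lemma arcs_length_ge0 B : 0 <= arcs_length B.
Proof. by apply: sumr_ge0 => a _; exact/ltW/len_gt0. Qed.

(* An arc with a direction of travel; [true] is from [src] to [tgt]. *)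
Definition dart : Type := (net_arc Q * bool)%type.
Definition dart_tail (e : dart) : net_node Q := if e.2 then src e.1 else tgt e.1.
Definition dart_head (e : dart) : net_node Q := if e.2 then tgt e.1 else src e.1.
Definition dart_point (e : dart) (u : R) : net_point :=
  arc_point e.1 (if e.2 then u else len e.1 - u).

Fixpoint is_walk (x : net_node Q) (w : seq dart) (y : net_node Q) : bool :=
  if w is e :: w' then (dart_tail e == x) && is_walk (dart_head e) w' y
  else x == y.

Definition walk_length (w : seq dart) : R := \sum_(e <- w) len e.1.

(* Position after traversing length [u] of the walk [w] from [x] *)
Fixpoint walk_point (x : net_node Q) (w : seq dart) (u : R) : net_point :=
  if w is e :: w' then
    if u < len e.1 then dart_point e u
    else walk_point (dart_head e) w' (u - len e.1)
  else Node x.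

Definition closed_covering_walk (x : net_node Q) (w : seq dart) : Prop :=
  is_walk x w x /\ forall a : net_arc Q, a \in [seq e.1 | e <- w].

Record euler_tour (B : {set net_arc Q}) := EulerTour {
  tour_start : net_node Q;
  tour_walk : seq dart;
  tour_closed : is_walk tour_start tour_walk tour_start;
  tour_once : perm_eq [seq e.1 | e <- tour_walk] (enum B) }.

Lemma walk_length_ge0 w : 0 <= walk_length w.
Proof. by apply: sumr_ge0 => e _; exact/ltW/len_gt0. Qed.

Lemma walk_length_cons e w : walk_length (e :: w) = len e.1 + walk_length w.
Proof. by rewrite /walk_length big_cons. Qed.

Lemma walk_length_tour B (T : euler_tour B) :
  walk_length (tour_walk T) = arcs_length B.
Proof.
rewrite /walk_length -(big_map fst xpredT len) (perm_big _ (tour_once T)) /=.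
by rewrite /arcs_length big_enum.
Qed.

Let reach x y m := exists2 l, l <= m & path_length x y l.

Let reach0 x : reach x x 0.
Proof. by exists 0 => //; exact: path_nil. Qed.

Let reachD x y z l m : reach x y l -> reach y z m -> reach x z (l + m).
Proof.
move=> [l' ll' p] [m' mm' q]; exists (l' + m'); first exact: lerD.
exact: path_lengthD p q.
Qed.

Let reachW x y l m : reach x y l -> l <= m -> reach x y m.
Proof. by move=> [l' ll' p] lm; exists l' => //; exact: le_trans lm. Qed.

Let reach_dart e u v : 0 <= u -> u <= v -> v <= len e.1 ->
  reach (dart_point e u) (dart_point e v) (v - u).
Proof.
move=> u0 uv vl; have ul := le_trans uv vl; have v0 := le_trans u0 uv.
rewrite /dart_point; case: e.2.
  exists (`|v - u| + 0); last by apply: path_cons (path_nil _); apply/andP.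
  by rewrite addr0 ger0_norm // subr_ge0.
exists (`|len e.1 - v - (len e.1 - u)| + 0).
  rewrite addr0 (_ : _ - _ = - (v - u)); last by ring.
  by rewrite normrN ger0_norm // subr_ge0.
by apply: path_cons (path_nil _); rewrite subr_ge0 lerBlDr lerDl ?ul ?vl ?u0 ?v0.
Qed.

Lemma dart_point0 e : dart_point e 0 = Node (dart_tail e).
Proof.
rewrite /dart_point /dart_tail; case: e.2; first by rewrite arc_point_src.
by rewrite subr0 arc_point_tgt.
Qed.

Lemma dart_pointl e : dart_point e (len e.1) = Node (dart_head e).
Proof.
rewrite /dart_point /dart_head; case: e.2; first by rewrite arc_point_tgt.
by rewrite subrr arc_point_src.
Qed.

Lemma walk_point0 x w y : is_walk x w y -> walk_point x w 0 = Node x.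
Proof.
by case: w => //= e w /andP[/eqP <- _]; rewrite len_gt0 dart_point0.
Qed.

Lemma walk_pointl x w y u :
  is_walk x w y -> walk_length w <= u -> walk_point x w u = Node y.
Proof.
elim: w x u => [x u /eqP -> //|e w IH x u /= /andP[_ hw]].
rewrite walk_length_cons => hu.
have := walk_length_ge0 w => w0.
rewrite ltNge (_ : len e.1 <= u) /=; last by lra.
by apply: IH => //; lra.
Qed.

Let reach_walk x w y u v : is_walk x w y -> 0 <= u -> u <= v ->
  reach (walk_point x w u) (walk_point x w v) (v - u).
Proof.
elim: w x u v => [x u v _ _ uv|e w IH x u v /= /andP[_ hw] u0 uv].
  by apply: reachW (reach0 _) _; rewrite subr_ge0.
have [vl|lv] := ltP v (len e.1).
  by rewrite (le_lt_trans uv vl); apply: reach_dart => //; exact: ltW.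
have [ul|lu] := ltP u (len e.1); last first.
  by apply: reachW (IH _ _ _ hw _ _) _; lra.
have h1 := reach_dart u0 (ltW ul) (lexx _).
rewrite dart_pointl -(walk_point0 hw) in h1.
have lv0 : 0 <= v - len e.1 by lra.
apply: reachW (reachD h1 (IH _ _ _ hw (lexx 0) lv0)) _; lra.
Qed.

(* The tour repeated with period its length *)
Definition tour_point B (T : euler_tour B) (u : R) : net_point :=
  let L := walk_length (tour_walk T) in
  walk_point (tour_start T) (tour_walk T) (u - L * (Num.floor (u / L))%:~R).

Lemma tour_point_lip B (T : euler_tour B) (u v : R) :
  dist (tour_point T u) (tour_point T v) <= `|u - v|.
Proof.
wlog uv : u v / u <= v.
  move=> H; case/orP: (le_total u v) => /H // h.
  rewrite distrC; apply: le_trans h.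
  suff -> : forall x y, dist x y = dist y x by [].
  move=> x y; congr inf; apply/seteqP; split=> l /=; exact: path_length_rev.
rewrite distrC ger0_norm ?subr_ge0 //.
suff [l lv p] : reach (tour_point T u) (tour_point T v) (v - u).
  exact: le_trans (dist_le p) lv.
rewrite /tour_point; set w := tour_walk T; set x := tour_start T.
have cw : is_walk x w x := tour_closed T.
have := walk_length_ge0 w; rewrite le_eqVlt => /orP[/eqP L0|L0].
  rewrite -L0 !mul0r !subr0 /=.
  have we : w = [::].
    case: (w) L0 => // e w'; rewrite walk_length_cons => L0.
    by have := ltr_wpDr (walk_length_ge0 w') (len_gt0 e.1); rewrite -L0 ltxx.
  by rewrite we /=; apply: reachW (reach0 _) _; rewrite subr_ge0.
set L := walk_length w in L0 *.
set k := Num.floor (u / L); set m := Num.floor (v / L).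
have fl (t : R) : 0 <= t - L * (Num.floor (t / L))%:~R < L.
  rewrite subr_ge0 mulrC -ler_pdivlMr // floor_le /=.
  have := floorD1_gt (t / L).
  by rewrite ltr_pdivrMr // intrD mulrDl mul1r ltrBlDl.
have km : k <= m by apply: le_floor; rewrite ler_pM2r ?invr_gt0.
have /andP[fu0 fuL] := fl u; have /andP[fv0 fvL] := fl v.
have [kEm|kNm] := eqVneq k m.
  by rewrite -kEm in fv0 fvL *; apply: reachW (reach_walk cw _ _) _ => //; lra.
have {kNm}km : (k + 1)%:~R <= m%:~R :> R.
  by rewrite ler_int lezD1 lt_neqAle kNm.
have h1 := reach_walk cw fu0 (ltW fuL).
rewrite (walk_pointl cw (lexx _)) -(walk_point0 cw) in h1.
apply: reachW (reachD h1 (reach_walk cw (lexx 0) fv0)) _.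
have := ler_wpM2l (ltW L0) km; rewrite intrD mulrDr mulr1.
rewrite -/k -/m; lra.
Qed.

Record patrol := Patrol {
  position :> {nonneg R} -> net_point;
  patrol_speed : forall s t : {nonneg R},
    dist (position s) (position t) <= `|s%:num - t%:num| }.

HB.instance Definition _ := gen_eqMixin patrol.
HB.instance Definition _ := gen_choiceMixin patrol.

Lemma dist_xx (x : net_point) : dist x x = 0.
Proof.
apply/eqP; rewrite eq_le dist_le /=; last exact: path_nil.
by apply: lb_le_inf => [|l /=]; [exists 0; exact: path_nil|exact: path_length_ge0].
Qed.

Lemma still_speed (s t : {nonneg R}) :
  dist (Node (base_node Q)) (Node (base_node Q)) <= `|s%:num - t%:num|.
Proof. by rewrite dist_xx. Qed.

HB.instance Definition _ := isPointed.Build patrol (Patrol still_speed).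

Definition cylinders : set (set patrol) :=
  [set A | exists t (B : set net_point),
     measurable B /\ A = [set S : patrol | B (S t)]].

(* The coarsest sigma-algebra making every evaluation [S |-> S t] measurable *)
HB.instance Definition _ := @isMeasurable.Build (sigma_display cylinders)
  patrol <<s cylinders >> (@sigma_algebra0 _ setT cylinders)
  (@sigma_algebraC _ cylinders) (@sigma_algebra_bigcup _ setT cylinders).

Lemma tour_patrol_speed B (T : euler_tour B) (u : R) (s t : {nonneg R}) :
  dist (tour_point T (u + s%:num)) (tour_point T (u + t%:num))
    <= `|s%:num - t%:num|.
Proof.
apply: le_trans (tour_point_lip _ _ _) _.
by rewrite opprD addrACA subrr add0r.
Qed.

Definition tour_patrol B (T : euler_tour B) (u : R) : patrol :=
  Patrol (tour_patrol_speed T u).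

Lemma tour_patrol_measurable B (T : euler_tour B) :
  measurable_fun [set: R] (tour_patrol T).
Proof.
apply: (@measurability _ _ _ _ _ _ cylinders) => //.
move=> _ [_ [t [C [mC ->]]] <-]; rewrite setTI.
have -> : tour_patrol T @^-1` [set S : patrol | C (S t)] =
    (fun u => tour_point T (u + t%:num)) @^-1` C by [].
rewrite -[X in measurable X]setTI.
apply: (lip_measurable _) => // u v.
apply: le_trans (tour_point_lip _ _ _) _.
by rewrite opprD addrACA subrr addr0.
Qed.

End network.

Section time.
Context (R : realType).

Definition time : Type := {nonneg R}.
HB.instance Definition _ := Choice.on time.
HB.instance Definition _ := isPointed.Build time (0%:nng : {nonneg R}).

Let num (t : time) : measurableTypeR R := (t : {nonneg R})%:num.
HB.instance Definition _ :=
  Measurable.copy time (g_sigma_algebra_preimageType num).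
End time.

Section game.
Context {R : realType} (Q : network R) (alpha : R).
Local Open Scope ereal_scope.

(* A place and a starting time, with the Borel sigma-algebra *)
Definition attack : Type := (net_point Q * time R)%type.

Definition intercepts (S : patrol Q) (a : attack) : Prop :=
  exists2 s : {nonneg R},
    ((a.2 : {nonneg R})%:num <= s%:num <= (a.2 : {nonneg R})%:num + alpha)%R &
    S s = a.1.

Definition lower_value : \bar R :=
  ereal_sup (range (fun p : probability (patrol Q) R =>
    ereal_inf (range (fun a : attack => p [set S | intercepts S a])))).

Definition upper_value : \bar R :=
  ereal_inf (range (fun q : probability attack R =>
    ereal_sup (range (fun S : patrol Q => q [set a | intercepts S a])))).

Definition is_value (V : \bar R) : Prop :=
  lower_value = V /\ upper_value = V.

(* Optimality in a game of value [V].  That the strategy is a probability is part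
   of the claim: the strategies defined below are measures for every network,
   but have total mass 1 only in the nondegenerate cases. *)
Definition patroller_optimal (V : \bar R)
    (p : {measure set patrol Q -> \bar R}) :=
  p setT = 1 /\ forall a : attack, V <= p [set S | intercepts S a].

Definition attacker_optimal (V : \bar R)
    (q : {measure set attack -> \bar R}) :=
  q setT = 1 /\ forall S : patrol Q, q [set a | intercepts S a] <= V.

End game.

Section strategies.
Context {R : realType} (Q : network R).

Lemma total_lengthV_ge0 : 0 <= (total_length Q)^-1.
Proof. by rewrite invr_ge0 arcs_length_ge0. Qed.

Definition uniform_point : {measure set net_point Q -> \bar R} :=
  mscale (NngNum total_lengthV_ge0) (lambda Q).

Definition uniform_attack (t : time R) : {measure set attack Q -> \bar R} :=
  mpush uniform_point (@pair2_measurable _ _ (net_point Q) (time R) t).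

Lemma tour_lengthV_ge0 B (T : @euler_tour _ Q B) :
  0 <= (walk_length (tour_walk T))^-1.
Proof. by rewrite invr_ge0 walk_length_ge0. Qed.

(* [T] followed at unit speed forever from a uniformly random starting point *)
Definition random_tour B (T : @euler_tour _ Q B) :
    {measure set patrol Q -> \bar R} :=
  mpush (mscale (NngNum (tour_lengthV_ge0 T))
           (mrestr (@lebesgue_measure R)
              (measurable_itv `[0, walk_length (tour_walk T)[)))
    (tour_patrol_measurable T).

Definition joins (a : net_arc Q) (u v : net_node Q) : bool :=
  ((src a, tgt a) == (u, v)) || ((src a, tgt a) == (v, u)).

Definition complete_network (m : nat) : Prop :=
  [/\ #|net_node Q| = m, forall a : net_arc Q, src a != tgt a &
      forall u v : net_node Q, u != v -> #|[set a | joins a u v]%SET| = 1%N].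

(* Counting incident arcs gives the degree in the absence of loops. *)
Definition perfect_matching (B : {set net_arc Q}) : Prop :=
  forall v : net_node Q,
    #|[set a in B | (src a == v) || (tgt a == v)]%SET| = 1%N.

Definition one_factorization (n : nat)
    (F : 'I_(2 * n - 1) -> {set net_arc Q}) : Prop :=
  [/\ forall i, perfect_matching (F i),
      forall i j, i != j -> [disjoint F i & F j]%bool &
      (\bigcup_i F i)%SET = [set: net_arc Q]%SET].

Definition delta n (F : 'I_(2 * n - 1) -> {set net_arc Q}) : R :=
  \big[Num.max/0]_i arcs_length (F i).

Lemma weight_ge0 n (F : 'I_(2 * n - 1) -> {set net_arc Q}) i :
  0 <= arcs_length (~: F i)%SET / ((2 * n - 2)%:R * total_length Q).
Proof. by rewrite divr_ge0 ?mulr_ge0 ?arcs_length_ge0. Qed.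

(* For each [i], an Eulerian tour [T i] of the network without the arcs of [F i]
   is chosen, and [random_tour (T i)] is played with probability
   lambda(Q - F i) / ((2n - 2) mu). *)
Definition complete_patrol n (F : 'I_(2 * n - 1) -> {set net_arc Q})
    (T : forall i, euler_tour (~: F i)%SET) :
    {measure set patrol Q -> \bar R} :=
  fin_msum (fun i => mscale (NngNum (weight_ge0 F i)) (random_tour (T i))).

End strategies.

(* Main.v *)
(* The lower bound for the patroller: if x lies on a tour of length L >= alpha,
   a uniformly started tour meets x during a time window of length alpha with
   probability at least alpha / L.  A point lies on at least 2n - 2 of the tours
   (exactly that many if it is interior to an arc), and the weights of the mixture
   turn each of them into a contribution alpha / ((2n - 2) mu).
   The upper bound for the attacker: a path of speed at most one covers a set of
   length measure at most alpha in time alpha.  Weak duality, hence the equality of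
   the two values, is Fubini's theorem for the measurable set of pairs
   (patrol, attack) such that the patrol intercepts the attack; Euler's theorem
   provides the tours. *)

From HB Require Import structures.
Require Import Defs.
From mathcomp Require Import all_boot all_order all_algebra.
From mathcomp Require Import all_classical all_reals all_analysis.
From mathcomp Require Import ring lra zify.
Set Implicit Arguments.
Unset Strict Implicit.
Unset Printing Implicit Defensive.
Import Order.TTheory GRing.Theory Num.Theory.
Import numFieldNormedType.Exports.
Local Open Scope classical_set_scope.
Local Open Scope ring_scope.

(** * Euler's theorem *)

Section euler.
Context {R : realType} (Q : network R).
Implicit Types (B C : {set net_arc Q}) (x y z v : net_node Q) (w : seq (dart Q)).

Definition incident v (a : net_arc Q) : bool := (src a == v) || (tgt a == v).
Definition degree B v : nat := #|[set a in B | incident v a]%SET|.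
Definition arcs w : seq (net_arc Q) := [seq e.1 | e <- w].
Definition nodes x w : seq (net_node Q) := x :: [seq dart_head e | e <- w].
Definition trail B x w y : bool :=
  [&& is_walk x w y, uniq (arcs w) & all [in B] (arcs w)].

Lemma degreeD1 B b v : b \in B ->
  degree B v = (incident v b + degree (B :\ b)%SET v)%N.
Proof.
move=> bB; rewrite /degree (cardsD1 b) inE bB /=; congr (_ + _)%N.
by apply: eq_card => a; rewrite !inE andbA.
Qed.

Lemma incident_tail v a : incident v a -> exists2 e : dart Q, e.1 = a & dart_tail e = v.
Proof. by case/orP => /eqP <-; [exists (a, true)|exists (a, false)]. Qed.

Lemma is_walk_cat x y z w1 w2 :
  is_walk x w1 y -> is_walk y w2 z -> is_walk x (w1 ++ w2) z.
Proof.
elim: w1 x => [x /eqP -> //|e w1 IH x /= /andP[-> h1] h2 /=].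
exact: IH.
Qed.

Hypothesis loopless : forall a : net_arc Q, src a != tgt a.

(** Without loops the two ends of a dart differ, so incidence is an exclusive or. Parities of
    degrees then reduce to sums of booleans. *)
Lemma incident_dart v (e : dart Q) :
  incident v e.1 = (v == dart_tail e) (+) (v == dart_head e).
Proof.
rewrite /incident !(eq_sym v) /dart_tail /dart_head.
have := loopless e.1; case: e.2 => /= h;
  case: (eqVneq (src e.1) v) => [sv|_]; rewrite /= ?addbF ?addFb //;
  by rewrite -sv eq_sym (negPf h).
Qed.

(* Greedy walk: removing an arc from [x] to [z] moves the odd vertex from [x] to [z]. *)
Lemma odd_trail B x y : x != y ->
  (forall v, odd (degree B v) = (v == x) (+) (v == y)) ->
  exists w, trail B x w y.
Proof.
have [k] := ubnP #|B|; elim: k B x => // k IH B x Bk xy odB.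
have : odd (degree B x) by rewrite odB eqxx (negPf xy).
rewrite /degree; case: (set_0Vmem [set a in B | incident x a]%SET) => [->|[b]].
  by rewrite cards0.
rewrite inE => /andP[bB /incident_tail[e eb ex]] _.
have tr w : trail (B :\ b)%SET (dart_head e) w y -> trail B x (e :: w) y.
  case/and3P => hw uw /allP sw; apply/and3P; split => /=.
  - by rewrite ex eqxx.
  - by rewrite uw andbT; apply/negP => /sw; rewrite eb !inE eqxx.
  - by rewrite eb bB; apply/allP => a /sw; rewrite inE => /andP[].
have [zy|zy] := eqVneq (dart_head e) y.
  by exists [:: e]; apply: tr; rewrite /trail /= zy eqxx.
have [|v|w hw] := IH (B :\ b)%SET (dart_head e) _ zy; last by exists (e :: w); exact: tr.
  by move: Bk; rewrite (cardsD1 b) bB.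
have := odB v; rewrite (degreeD1 _ bB) oddD -eb incident_dart ex.
by rewrite oddb; do 3!case: (v == _); case: odd.
Qed.

(** Deleting [b] from an even arc set makes exactly its two ends odd. The trail given by [odd_trail]
    from the far end back to [x] closes up with [b]. *)
Lemma closed_trail B x b : (forall v, ~~ odd (degree B v)) ->
  b \in B -> incident x b -> exists e w, trail B x (e :: w) x.
Proof.
move=> evB bB /incident_tail[e eb ex].
have xe : dart_head e != x.
  have := incident_dart x e; rewrite -ex eqxx /=.
  rewrite /incident /dart_tail; have := loopless e.1; rewrite /dart_head.
  by case: e.2; rewrite eq_sym.
have [v|w /and3P[hw uw /allP sw]] := odd_trail xe (B := (B :\ b)%SET).
  have := evB v; rewrite (degreeD1 _ bB) oddD -eb incident_dart ex oddb.
  by do 2!case: (v == _); case: odd.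
exists e, w; apply/and3P; split => /=.
- by rewrite ex eqxx.
- by rewrite uw andbT; apply/negP => /sw; rewrite eb !inE eqxx.
- by rewrite eb bB; apply/allP => a /sw; rewrite inE => /andP[].
Qed.

(** Each passage through an intermediate node uses two arcs, so only the two ends of the walk affect
    the parity. *)
Lemma odd_incident_walk x y w v : is_walk x w y ->
  odd (count (incident v) (arcs w)) = (v == x) (+) (v == y).
Proof.
elim: w x => [x /eqP -> /=|e w IH x /= /andP[/eqP ex hw]].
  by rewrite addbb.
rewrite oddD (IH _ hw) incident_dart ex oddb.
by do 3!case: (v == _).
Qed.

Lemma trail_degree B x y w v : trail B x w y ->
  degree B v = (count (incident v) (arcs w) + degree (B :\: [set:: arcs w])%SET v)%N.
Proof.
case/and3P => _ uw /allP sw.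
rewrite /degree -(cardsID [set:: arcs w]%SET); congr (_ + _)%N; last first.
  by apply: eq_card => a; rewrite !inE andbA.
rewrite -size_filter -(card_uniqP (filter_uniq _ uw)).
apply: eq_card => a; rewrite !inE mem_filter andbC.
by case: (boolP (a \in arcs w)) => [/sw -> |]; rewrite ?andbF ?andbT.
Qed.

Lemma mem_nodes x w z y : is_walk x w z -> y \in nodes x w ->
  exists w1 w2, w = w1 ++ w2 /\ is_walk x w1 y /\ is_walk y w2 z.
Proof.
elim: w x => [x /eqP xz|e w IH x /= /andP[/eqP ex hw]].
  by rewrite inE => /eqP ->; exists [::], [::]; rewrite /= xz !eqxx.
rewrite inE => /predU1P[->|].
  by exists [::], (e :: w); rewrite /= eqxx ex eqxx.
move=> /(IH _ hw)[w1 [w2 [-> [h1 h2]]]]; exists (e :: w1), w2.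
by rewrite /= ex eqxx.
Qed.

Lemma walk_incident x w z a : is_walk x w z -> a \in arcs w ->
  (src a \in nodes x w) /\ (tgt a \in nodes x w).
Proof.
elim: w x => // e w IH x /= /andP[/eqP ex hw]; rewrite inE /nodes /=.
case/predU1P => [->|/(IH _ hw)[h1 h2]].
  rewrite !in_cons -ex /dart_tail /dart_head.
  by case: e.2; rewrite !eqxx ?orbT.
by rewrite !(in_cons x) -/(nodes (dart_head e) w) h1 h2 !orbT.
Qed.

(* The missing arcs have even degrees, one of them touches the trail by
   connectedness, and a closed trail through it can be inserted there. *)
Lemma euler_extend B x w : (forall v, ~~ odd (degree B v)) ->
  (forall W : {set net_node Q}, (exists v, v \in W) ->
     (forall a, a \in B -> (src a \in W) = (tgt a \in W)) -> W = [set: net_node Q]%SET) ->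
  trail B x w x -> (size w < #|B|)%N ->
  exists y w', trail B y w' y /\ (size w < size w')%N.
Proof.
move=> evB conB tw swB; have /and3P[hw uw /allP sw] := tw.
set C := (B :\: [set:: arcs w])%SET.
have evC v : ~~ odd (degree C v).
  by have := evB v; rewrite (trail_degree v tw) oddD (odd_incident_walk v hw) addbb.
have [c cC] : exists c, c \in C.
  apply/set0Pn; apply: contraTneq swB => /eqP; rewrite finset.setD_eq0 => /subset_leq_card.
  rewrite -leqNgt => /leq_trans; apply.
  rewrite (leq_trans (_ : _ <= #|arcs w|)%N) //.
    by apply: subset_leq_card; apply/fintype.subsetP => a; rewrite inE.
  by rewrite (leq_trans (card_size _)) // size_map.
have [b [y [bC yb yw]]] : exists b y, [/\ b \in C, incident y b & y \in nodes x w].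
  apply: contrapT => H.
  have nH b y : b \in C -> incident y b -> y \notin nodes x w.
    by move=> *; apply/negP => ?; apply: H; exists b, y.
  (* Trail arcs have both ends among the trail nodes and, by [nH], the remaining arcs have none. So
     no arc of [B] leaves this node set, which must be everything and contain [src c]. *)
  have /setP/(_ (src c)) : [set y in nodes x w]%SET = [set: net_node Q]%SET.
    apply: conB => [|a aB]; first by exists x; rewrite !inE eqxx.
    rewrite !inE.
    have [aw|aw] := boolP (a \in arcs w).
      by have [] := walk_incident hw aw; rewrite !inE => -> ->.
    have aC : a \in C by rewrite !inE aw.
    have := nH a (src a) aC; have := nH a (tgt a) aC.
    rewrite /incident !eqxx orbT !inE => /(_ isT) /negPf -> /(_ isT) /negPf ->//.
  have := nH c (src c) cC; rewrite /incident eqxx !inE => /(_ isT) /negPf ->.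
  by [].
have [e [w' /and3P[hw' uw' /allP sw']]] := closed_trail evC bC yb.
have [w1 [w2 [def_w [h1 h2]]]] := mem_nodes hw yw.
(* The old trail is rotated to start at [y], and the new closed trail is put in front. *)
exists y, ((e :: w') ++ w2 ++ w1); split; last first.
  by rewrite def_w !size_cat /= addnC; lia.
have pw : perm_eq (arcs (w2 ++ w1)) (arcs w).
  by rewrite def_w /arcs perm_map // perm_catC.
apply/and3P; split.
- by apply: is_walk_cat hw' _; exact: is_walk_cat h2 h1.
- rewrite /arcs map_cat cat_uniq uw' (perm_uniq pw) uw andbT.
  apply/hasPn => a; rewrite /= -/(arcs _) (perm_mem pw) => aw.
  by apply/negP => /sw'; rewrite !inE aw.
- rewrite /arcs map_cat all_cat; apply/andP; split; apply/allP => a.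
    by move/sw'; rewrite inE => /andP[].
  by rewrite -/(arcs _) (perm_mem pw) => /sw.
Qed.

(** Repeated use of [euler_extend] gives a closed trail with at least [#|B|] arcs. Being
    duplicate-free and inside [B], it enumerates [B]. Connectedness is expressed by cuts: no proper
    nonempty node set is closed under the arcs of [B]. *)
Theorem euler_tour_exists B : (forall v, ~~ odd (degree B v)) ->
  (forall W : {set net_node Q}, (exists v, v \in W) ->
     (forall a, a \in B -> (src a \in W) = (tgt a \in W)) -> W = [set: net_node Q]%SET) ->
  inhabited (euler_tour B).
Proof.
move=> evB conB.
have long k : (k <= #|B|)%N -> exists x w, trail B x w x /\ (k <= size w)%N.
  elim: k => [_|k IH kB].
    by exists (base_node Q), [::]; rewrite /trail /= eqxx.
  have [x [w [tw kw]]] := IH (ltnW kB).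
  have [wB|Bw] := ltnP (size w) #|B|; last by exists x, w; rewrite (leq_trans kB).
  have [y [w' [tw' ww']]] := euler_extend evB conB tw wB.
  by exists y, w'; rewrite (leq_trans _ ww').
have [x [w [/and3P[hw uw /allP sw] szw]]] := long _ (leqnn _).
constructor; apply: (EulerTour hw).
rewrite uniq_perm ?enum_uniq // => a.
have sub : {subset arcs w <= enum B} by move=> b /sw; rewrite mem_enum.
by have [] := uniq_min_size uw sub; rewrite // -cardE size_map.
Qed.

End euler.

(** * Tours of the complements of the factors *)

Section factorization.
Context {R : realType} (Q : network R) (n : nat).
Variable F : 'I_(2 * n - 1) -> {set net_arc Q}.
Hypotheses (completeQ : complete_network Q (2 * n)) (factF : one_factorization F).
Hypothesis n_gt1 : (1 < n)%N.

(** The colouring [k] encodes the partition into factors, so that sums over factors can be regrouped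
    by [partition_big]. *)
Lemma factor_index : exists k : net_arc Q -> 'I_(2 * n - 1),
  forall a i, (a \in F i) = (k a == i).
Proof.
have [_ dF cF] := factF.
have /choice [k kF] (a : net_arc Q) : exists i, a \in F i.
  have : a \in (\bigcup_i F i)%SET by rewrite cF inE.
  by case/bigcupP => i _; exists i.
exists k => a i; have [<-|ki] := eqVneq (k a) i; first exact: kF.
by apply/negbTE; apply: contraL (dF _ _ ki) => aF; apply/pred0Pn; exists a; rewrite /= kF.
Qed.

Lemma sum_factors (V : nmodType) (g : net_arc Q -> V) :
  \sum_i \sum_(a in F i) g a = \sum_a g a.
Proof.
have [k kF] := factor_index.
rewrite [RHS](partition_big k xpredT) //=; apply: eq_bigr => i _.
by apply: eq_bigl => a; rewrite kF.
Qed.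

Lemma sum_arcs_length : \sum_i arcs_length (F i) = total_length Q.
Proof.
rewrite sum_factors /total_length /arcs_length.
by apply: eq_bigl => a; rewrite inE.
Qed.

Lemma arcs_lengthC (B : {set net_arc Q}) :
  arcs_length (~: B)%SET = total_length Q - arcs_length B.
Proof.
rewrite /total_length /arcs_length [X in _ = X - _](big_setID B) /= finset.setTI finset.setTD.
by rewrite addrAC subrr add0r.
Qed.

Lemma degreeE (B : {set net_arc Q}) v : degree B v = (\sum_(a in B) incident v a)%N.
Proof.
rewrite /degree -sum1_card [RHS]big_mkcond [LHS]big_mkcond /=; apply: eq_bigr => a _.
by rewrite inE; case: (a \in B); case: incident.
Qed.

(** Each of the 2n - 1 factors has one arc at [v] and together they contain all arcs there; one
    factor is removed. *)
Lemma degreeC i v : degree (~: F i)%SET v = (2 * n - 2)%N.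
Proof.
have [pF _ _] := factF.
have dF j : degree (F j) v = 1%N by exact: pF.
have : (\sum_a incident v a = 2 * n - 1)%N.
  rewrite -(sum_factors (fun a => (incident v a : nat))).
  under eq_bigr do rewrite -degreeE dF.
  by rewrite sum1_card card_ord.
rewrite (bigID [in F i]) /= -degreeE dF => E.
rewrite degreeE; under eq_bigl do rewrite inE.
by apply: (@addnI 1); rewrite E; lia.
Qed.

Lemma even_degreeC i v : ~~ odd (degree (~: F i)%SET v).
Proof. by rewrite degreeC oddB ?oddM //; lia. Qed.

Lemma joins_exists (u v : net_node Q) : u != v -> exists a, joins a u v.
Proof.
have [_ _ c1] := completeQ; move=> /c1 /eqP /cards1P[a /setP/(_ a)].
by rewrite !inE eqxx; exists a.
Qed.

(** If [W] were proper, every arc across the cut would lie in the matching [F i]. Since 2n > 2 there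
    is a third node, which yields two crossing arcs with a common end. *)
Lemma complement_connected i (W : {set net_node Q}) : (exists v, v \in W) ->
  (forall a, a \in (~: F i)%SET -> (src a \in W) = (tgt a \in W)) ->
  W = [set: net_node Q]%SET.
Proof.
move=> [u uW] closedW; apply/setP => v; rewrite [RHS]inE; apply/negPn/negP => vW.
have [cardQ _ _] := completeQ; have [pF _ _] := factF.
have cross (x y : net_node Q) : x \in W -> y \notin W ->
    exists a, a \in F i /\ [set src a; tgt a]%SET = [set x; y]%SET.
  move=> xW yW; have [|a] := @joins_exists x y.
    by apply: contraNneq yW => <-.
  move=> ja; exists a.
  have [[sa ta]|[sa ta]] : src a = x /\ tgt a = y \/ src a = y /\ tgt a = x.
    by case/orP: ja => /eqP[-> ->]; [left|right].
    split; last by rewrite sa ta.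
    apply: contraT => aF; have := closedW a; rewrite inE aF sa ta xW (negPf yW).
    by move=> /(_ isT).
  split; last by rewrite sa ta finset.setUC.
  apply: contraT => aF; have := closedW a; rewrite inE aF sa ta xW (negPf yW).
  by move=> /(_ isT).
have uniqF (x : net_node Q) a b : a \in F i -> b \in F i ->
    x \in [set src a; tgt a]%SET -> x \in [set src b; tgt b]%SET -> a = b.
  move=> aF bF xa xb; have /eqP/cards1P[c cE] := pF i x.
  have : a \in [set c]%SET by rewrite -cE inE aF; move: xa; rewrite !inE !(eq_sym x).
  have : b \in [set c]%SET by rewrite -cE inE bF; move: xb; rewrite !inE !(eq_sym x).
  by rewrite !inE => /eqP -> /eqP ->.
(* [u z] or [z v] also crosses the cut, and shares an end with [u v]. *)
have [z zuv] : exists z, z \notin [set u; v]%SET.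
  apply/existsP; rewrite -negb_forall; apply/negP => /forallP all_uv.
  have : (#|[set: net_node Q]%SET| <= #|[set u; v]%SET|)%N.
    by apply: subset_leq_card; apply/fintype.subsetP => x _.
  rewrite cardsT cardQ cards2; case: (u != v) => /=; lia.
have [a [aF aE]] := cross _ _ uW vW.
have [zW|zW] := boolP (z \in W).
  have [b [bF bE]] := cross _ _ zW vW.
  have ab : a = b by apply: (uniqF v); rewrite // ?aE ?bE !inE eqxx orbT.
  by move: zuv; rewrite -aE ab bE !inE eqxx.
have [b [bF bE]] := cross _ _ uW zW.
have ab : a = b by apply: (uniqF u); rewrite // ?aE ?bE !inE eqxx.
by move: zuv; rewrite -aE ab bE !inE eqxx orbT.
Qed.

Lemma complement_tour : inhabited (forall i, euler_tour (~: F i)%SET).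
Proof.
have [_ loopless _] := completeQ.
constructor => i.
have : inhabited (euler_tour (~: F i)%SET).
  apply: (@euler_tour_exists _ Q loopless _ (even_degreeC i)) => W.
  exact: complement_connected.
by move=> /inhabited_witness.
Qed.

Lemma delta_ge i : arcs_length (F i) <= delta F.
Proof. exact: (le_bigmax _ (fun j => arcs_length (F j))). Qed.
End factorization.

(** * The distance of a network *)

Section metric.
Context {R : realType} (Q : network R).
Implicit Types (x y z : net_point Q) (a : net_arc Q).

Lemma arc_pointE a t (h : 0 < t < len a) : arc_point a t = Inner h.
Proof.
rewrite /arc_point; case: {-}_ / idP => [h'|//].
by rewrite (bool_irrelevance h h').
Qed.

Variant net_point_spec : net_point Q -> Prop :=
| NodeSpec v : net_point_spec (Node v)
| ArcSpec a t of 0 < t < len a : net_point_spec (arc_point a t).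

Lemma net_pointP x : net_point_spec x.
Proof. by case: x => [v|a t h]; [|rewrite -arc_pointE]; constructor. Qed.

(** Connectedness makes [dist] an infimum over a nonempty set, as every lower bound on it by
    [lb_le_inf] requires. *)
Lemma path_exists x y : exists l, path_length x y l.
Proof.
have in0 a : 0 <= (0 : R) <= len a by rewrite lexx ltW ?len_gt0.
have inl a : 0 <= len a <= len a by rewrite lexx ltW ?len_gt0.
have sn (u : net_point Q) : exists v l, path_length (Node v) u l.
  case: (net_pointP u) => [v|a t /andP[t0 tl]].
    by exists v, 0; exact: path_nil.
  exists (src a), (`|t - 0| + 0); rewrite -(@arc_point_src _ _ a 0) //.
  by apply: path_cons; rewrite ?(in0, inl) ?ltW //; exact: path_nil.
have [u [l ul]] := sn x; have [v [m vm]] := sn y.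
have [k uvk] : exists k, path_length (@Node _ Q u) (@Node _ Q v) k.
  have /connectP[p + ->] := @Defs.connectedP _ Q u v.
  elim: p u {l ul} => [u _|w p IH u /= /andP[/existsP[a auw] /IH[l pl]]].
    by exists 0; exact: path_nil.
  case/orP: auw => /eqP[ua wa]; rewrite -ua -wa in pl *.
    exists (`|len a - 0| + l); rewrite -(@arc_point_src _ _ a 0) //.
    by apply: path_cons; rewrite ?(in0, inl) // arc_point_tgt.
  exists (`|0 - len a| + l); rewrite -(@arc_point_tgt _ _ a (len a)) //.
  by apply: path_cons; rewrite ?(in0, inl) // arc_point_src.
by exists (l + (k + m)); exact: path_lengthD (path_length_rev ul) (path_lengthD uvk vm).
Qed.

Lemma dist_ge0 x y : 0 <= dist x y.
Proof.
by apply: lb_le_inf => [|l]; [exact: path_exists|exact: path_length_ge0].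
Qed.

Lemma dist_sym x y : dist x y = dist y x.
Proof. by congr inf; apply/seteqP; split=> l /=; exact: path_length_rev. Qed.

Lemma dist_triangle y x z : dist x z <= dist x y + dist y z.
Proof.
rewrite -lerBlDr; apply: lb_le_inf => [|l xyl]; first exact: path_exists.
rewrite lerBlDr -lerBlDl; apply: lb_le_inf => [|m yzm]; first exact: path_exists.
by rewrite lerBlDl; apply: dist_le; exact: path_lengthD xyl yzm.
Qed.

(** The tool for bounding [dist] from below: a path is a chain of arc segments, so a test function
    that is 1-Lipschitz on closed arcs is so globally. *)
Lemma lipschitz_on_arcs (phi : net_point Q -> R) :
  (forall a s t, 0 <= s <= len a -> 0 <= t <= len a ->
     `|phi (arc_point a s) - phi (arc_point a t)| <= `|s - t|) ->
  forall x y, `|phi x - phi y| <= dist x y.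
Proof.
move=> lip x y; apply: lb_le_inf => [|l]; first exact: path_exists.
elim=> {x y l} [x|a s t y l hs ht _ IH]; first by rewrite subrr normr0.
apply: le_trans (ler_distD (phi (arc_point a t)) _ _) _.
by rewrite lerD // distrC lip.
Qed.

(** A path shorter than [r] cannot reach an end of the arc, so near [arc_point a u] the network is
    isometric to an interval. *)
Lemma dist_inner a u r y : r <= u -> r <= len a - u ->
  dist (arc_point a u) y < r ->
  exists2 v, y = arc_point a v & `|u - v| <= dist (arc_point a u) y.
Proof.
move=> ru rl dr; have r0 : 0 < r := le_lt_trans (dist_ge0 _ _) dr.
(* [phi] is the distance to [arc_point a u] truncated at [r]. *)
pose phi z := match z with
  Inner b t _ => if b == a then Num.min `|t - u| r else r | Node _ => r end.
(* The formula extends to the ends of the arcs: both ends of [a] are at least [r] away from [u], so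
   the truncation gives the node value [r]. *)
have phiE b t : 0 <= t <= len b ->
    phi (arc_point b t) = if b == a then Num.min `|t - u| r else r.
  move=> /andP[]; rewrite le_eqVlt => /predU1P[<- _|t0].
    rewrite arc_point_src //=; case: eqP => // _.
    by rewrite sub0r normrN min_r // ger0_norm; lra.
  rewrite le_eqVlt => /predU1P[->|tl]; last first.
    by rewrite (@arc_pointE _ t) ?t0.
  rewrite arc_point_tgt //=; case: eqP => // ->.
  by rewrite min_r // ger0_norm; lra.
have lip : forall x y, `|phi x - phi y| <= dist x y.
  apply: lipschitz_on_arcs => b s t hs ht; rewrite !phiE //.
  case: eqP => _; last by rewrite subrr normr0.
  have : `| `|s - u| - `|t - u| | <= `|s - t|.
    by apply: le_trans (ler_dist_dist _ _) _; rewrite opprB addrA subrK.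
  rewrite !ler_norml /Num.min; do 2!case: ifPn; rewrite -?leNgt; lra.
have := lip y (arc_point a u); rewrite dist_sym.
rewrite phiE ?subrr ?normr0 ?eqxx; last by apply/andP; split; lra.
rewrite (min_l (ltW r0)) subr0 => le.
have := le_lt_trans (le_trans (ler_norm _) le) dr.
case: y le {dr} => [v|b t h] /=; first by rewrite ltxx.
rewrite -arc_pointE; case: eqP => [->|_]; last by rewrite ltxx.
rewrite distrC => + lt; exists t => //; apply: le_trans (ler_norm _) _.
by apply: le_trans le; move: lt; rewrite gt_min ltxx orbF => /ltW/min_l ->; rewrite normr_id.
Qed.

Lemma min_len_gt0 : exists2 m : R, 0 < m & forall a, m <= len a.
Proof.
(* The default 1 covers a network without arcs. *)
exists (\big[Num.min/1]_(a : net_arc Q) len a); last by move=> a; exact: bigmin_le.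
by apply: lt_bigmin => // a _; exact: len_gt0.
Qed.

(** This turns zero distance into an actual interception. For an inner point [dist_inner] applies;
    two distinct nodes are separated by a test function whose slopes are at most one because its
    node values differ by at most the shortest arc length. *)
Lemma dist_eq0 x y : dist x y = 0 -> x = y.
Proof.
have inner a t z : 0 < t < len a -> dist (arc_point a t) z = 0 -> arc_point a t = z.
  move=> /andP[t0 tl] d0.
  have [||| v zE] := @dist_inner a t (Num.min t (len a - t)) z.
  - by rewrite ge_min lexx.
  - by rewrite ge_min lexx orbT.
  - by rewrite d0 lt_min t0 subr_gt0.
  by rewrite d0 normr_le0 subr_eq0 zE => /eqP ->.
case: (net_pointP x) => [u|a t /inner]; last exact.
case: (net_pointP y) => [v|a t /inner aP]; last by rewrite dist_sym => /aP.
move=> uv0; congr Node; apply/eqP/negPn/negP => uv.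
have [m m0 ml] := min_len_gt0.
(* [phi] interpolates linearly the function [h] separating [u] from the other nodes. *)
pose h v : R := if v == u then 0 else m.
have hl (v1 v2 : net_node Q) : `|h v1 - h v2| <= m.
  by rewrite /h ler_norml; do 2!case: ifP => _; lra.
pose phi z := match z with
  Inner b t _ => h (src b) + t * ((h (tgt b) - h (src b)) / len b) | Node v => h v end.
have phiE b t : 0 <= t <= len b ->
    phi (arc_point b t) = h (src b) + t * ((h (tgt b) - h (src b)) / len b).
  move=> /andP[]; rewrite le_eqVlt => /predU1P[<- _|t0].
    by rewrite arc_point_src //= mul0r addr0.
  rewrite le_eqVlt => /predU1P[->|tl]; last first.
    by rewrite (@arc_pointE _ t) ?t0.
  by rewrite arc_point_tgt //= mulrC divfK ?gt_eqF ?len_gt0 // addrC subrK.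
have lip : forall x y, `|phi x - phi y| <= dist x y.
  apply: lipschitz_on_arcs => b s t hs ht; rewrite !phiE //.
  rewrite opprD addrACA subrr add0r -mulrBl normrM ler_piMr // normrM.
  rewrite normfV (gtr0_norm (len_gt0 b)) ler_pdivrMr ?len_gt0 // mul1r.
  exact: le_trans (ml b).
have := lip (Node u) (Node v); rewrite uv0 /= /h eqxx eq_sym (negPf uv).
by rewrite sub0r normrN gtr0_norm // leNgt m0.
Qed.

End metric.

(** * Measurability of interception *)

Section interception.
Context {R : realType} (Q : network R) (alpha : R).
Hypothesis alpha_ge0 : 0 <= alpha.
Implicit Types (x y z : net_point Q) (S : patrol Q).

Lemma measurable_ball z (e : R) : measurable [set x | dist x z < e].
Proof.
apply: sub_sigma_algebra => x /= xe; exists (e - dist x z).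
  by rewrite subr_gt0.
move=> y xy; apply: le_lt_trans (dist_triangle x _ _) _.
by rewrite (dist_sym y x) -ltrBrDr.
Qed.

Lemma measurable_eval t (B : set (net_point Q)) :
  measurable B -> measurable [set S : patrol Q | B (S t)].
Proof. by move=> mB; apply: sub_sigma_algebra; exists t, B. Qed.

Lemma measurable_time : measurable_fun [set: time R]
  (fun t => (t : {nonneg R})%:num : measurableTypeR R).
Proof. by move=> _ B mB; rewrite setTI; exists B => //; rewrite setTI. Qed.

(** A countable dense family; any rational may serve as coordinate because [arc_point] clamps it. *)
Definition dense_point (z : net_node Q + net_arc Q * rat) : net_point Q :=
  match z with inl v => Node v | inr (a, q) => arc_point a (ratr q) end.

Lemma dense_pointP x (e : R) : 0 < e -> exists d, dist x (dense_point d) < e.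
Proof.
move=> e0; case: (net_pointP x) => [v|a t _].
  by exists (inl v); rewrite dist_xx.
have [q] := @rat_in_itvoo R t (t + e) ltac:(lra).
rewrite in_itv /= => /andP[tq qte]; exists (inr (a, q)) => /=.
by apply: le_lt_trans (arc_point_lip _ _ _) _; rewrite distrC gtr0_norm; lra.
Qed.

(** The absolute value extends a patrol continuously to the whole real line, where the extreme value
    theorem is available. *)
Definition abs_time (s : R) : {nonneg R} := `|s|%:nng.
Definition rat_time (q : rat) : {nonneg R} := abs_time (ratr q).

Lemma abs_timeE (s : R) : 0 <= s -> (abs_time s)%:num = s.
Proof. exact: ger0_norm. Qed.

(* Countably many measurable conditions, sufficient to describe interception because
   patrols are continuous and the time window is compact. *)
Definition near_intercepts (k : nat)
    (j : rat * (net_node Q + net_arc Q * rat)) : set (patrol Q * attack Q) :=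
  [set p : patrol Q * attack Q | let t := (p.2.2 : {nonneg R})%:num in let e := k.+1%:R^-1 in
     [/\ t - e < (rat_time j.1)%:num < t + alpha + e,
         dist (p.1 (rat_time j.1)) (dense_point j.2) < e &
         dist p.2.1 (dense_point j.2) < e]].

Lemma patrol_dist_continuous S x :
  continuous (fun s : R => dist (S (abs_time s)) x).
Proof.
move=> s; apply/cvgrPdist_lt => e e0; near=> s'.
have ss : `|s - s'| < e by near: s'; apply/nbhs_ballP; exists e => //=.
suff : `|dist (S (abs_time s)) x - dist (S (abs_time s')) x| <= `|s - s'|.
  by move=> /le_lt_trans; apply.
have h := patrol_speed S (abs_time s) (abs_time s').
have h2 := ler_dist_dist s s'; have := le_trans h h2.
have := dist_triangle (S (abs_time s)) (S (abs_time s')) x.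
have := dist_triangle (S (abs_time s')) (S (abs_time s)) x.
rewrite (dist_sym (S (abs_time s')) (S (abs_time s))) ler_norml /=; lra.
Unshelve. all: by end_near. Qed.

Lemma interceptsP :
  [set p : patrol Q * attack Q | intercepts alpha p.1 p.2] =
  \bigcap_k \bigcup_j near_intercepts k j.
Proof.
apply/seteqP; split => -[S [x t]] /=.
  move=> [s /= /andP[ts st] Ssx] k _; set e : R := k.+1%:R^-1.
  have e0 : 0 < e by rewrite invr_gt0.
  have s0 : 0 <= s%:num by [].
  have [q] := @rat_in_itvoo R s%:num (s%:num + e / 2) ltac:(lra).
  rewrite in_itv /= => /andP[sq qs].
  have [z xz] := @dense_pointP x (e / 2) ltac:(lra).
  have qE : (rat_time q)%:num = ratr q by rewrite abs_timeE //; lra.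
  have := patrol_speed S (rat_time q) s; rewrite qE Ssx ger0_norm; last lra.
  move=> Sq; exists (q, z) => //; split; rewrite -?/e /= -?/e.
  - by rewrite -[`|_|]/(rat_time q)%:num qE; lra.
  - by apply: le_lt_trans (dist_triangle x _ _) _; lra.
  - by lra.
move=> H; set g := fun s : R => dist (S (abs_time s)) x.
have tt : t%:num <= t%:num + alpha by rewrite lerDl.
have [c + cmin] := @EVT_min R g t%:num (t%:num + alpha) tt
  (continuous_subspaceT (@patrol_dist_continuous S x)).
rewrite in_itv /= => /andP[tc ct].
have c0 : 0 <= c by apply: le_trans tc.
exists (abs_time c); first by rewrite abs_timeE // tc.
apply: dist_eq0; apply/eqP; rewrite eq_le dist_ge0 andbT leNgt; apply/negP => gc.
(* Three errors below or equal to [e] add up: moving the rational time into the window, and the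
   distances of the patrol and of [x] to the dense point. *)
have [k] := @ltr_add_invr R 0 (dist (S (abs_time c)) x / 3) ltac:(lra).
rewrite add0r; set e : R := k.+1%:R^-1 => ke.
have [[q z] _ /= []] := H k I; rewrite -/e => /andP[q1 q2] Sqz xz.
set u := (rat_time q)%:num in q1 q2 *.
rewrite /= in gc q1 q2 Sqz xz.
have e0 : 0 < e by rewrite invr_gt0.
(* The projection of [u] onto the time window. *)
pose v := Num.max t%:num (Num.min u (t%:num + alpha)).
have vt : v \in `[t%:num, t%:num + alpha].
  by rewrite in_itv /= le_max lexx /= ge_max tt ge_min lexx orbT.
have v0 : 0 <= v by rewrite le_max [_ <= t%:num]ge0.
have uv : `|v - u| <= e.
  rewrite ler_norml /v /Num.max /Num.min.
  by do 2!case: ifPn; rewrite -?leNgt => *; apply/andP; split; lra.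
have := cmin _ vt; rewrite /g.
have := patrol_speed S (abs_time v) (rat_time q).
rewrite (abs_timeE v0) -/u.
have := dist_triangle (S (rat_time q)) (S (abs_time v)) x.
have := dist_triangle (dense_point z) (S (rat_time q)) x.
rewrite (dist_sym (dense_point z) x); lra.
Qed.

(** Joint measurability is what Fubini needs. The dense point separates the patrol from the attacked
    point, so each approximating set is an intersection of conditions on the time, the patrol and
    the place alone. *)
Lemma measurable_intercepts :
  measurable [set p : patrol Q * attack Q | intercepts alpha p.1 p.2].
Proof.
rewrite interceptsP; apply: bigcapT_measurable => k.
apply: countable_bigcupT_measurable => [|[q z]]; first exact: countableP.
set e : R := k.+1%:R^-1.
have -> : near_intercepts k (q, z) =
    ((fun p : patrol Q * attack Q => (p.2.2 : {nonneg R})%:num : measurableTypeR R) @^-1`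
       [set t | t - e < (rat_time q)%:num < t + alpha + e]) `&`
    (fst @^-1` [set S : patrol Q | dist (S (rat_time q)) (dense_point z) < e]) `&`
    ((fun p : patrol Q * attack Q => p.2.1) @^-1` [set x | dist x (dense_point z) < e]).
  by apply/seteqP; split => -[S [x t]] /=; [move=> []|move=> [[]]].
apply: measurableI; first apply: measurableI.
- rewrite -[X in measurable X]setTI.
  have mf : measurable_fun setT (fun p : patrol Q * attack Q =>
      (p.2.2 : {nonneg R})%:num : measurableTypeR R).
    apply: (measurableT_comp measurable_time).
    by apply: measurableT_comp measurable_snd; exact: measurable_snd.
  apply: mf => //.
  rewrite (_ : [set t | _] = `](rat_time q)%:num - alpha - e, (rat_time q)%:num + e[%classic) //.
  by apply/seteqP; split => r /=; rewrite in_itv /=; lra.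
- rewrite -[X in measurable X]setTI; apply: measurable_fst => //.
  by apply: (@measurable_eval _ [set x | dist x _ < e]); exact: measurable_ball.
- rewrite -[X in measurable X]setTI.
  apply: (measurableT_comp measurable_fst measurable_snd) => //.
  exact: measurable_ball.
Qed.

Lemma measurable_patrols (a : attack Q) :
  measurable [set S : patrol Q | intercepts alpha S a].
Proof.
have := measurable_ysection a measurable_intercepts.
by congr measurable; apply/seteqP; split => S; rewrite /ysection /= inE.
Qed.

Lemma measurable_attacks S : measurable [set a : attack Q | intercepts alpha S a].
Proof.
have := measurable_xsection S measurable_intercepts.
by congr measurable; apply/seteqP; split => a; rewrite /xsection /= inE.
Qed.

End interception.

(** * The patrolling strategy *)

Section patroller.
Context {R : realType} (Q : network R).

Lemma lebesgue_itvoo (a b : R) : a <= b ->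
  @lebesgue_measure R `]a, b[%classic = (b - a)%:E.
Proof.
move=> ab; rewrite lebesgue_measure_itv /= lte_fin.
by case: ltgtP ab => // ->; rewrite subrr.
Qed.

Section tour.
Variables (B : {set net_arc Q}) (T : euler_tour B).
Local Notation L := (walk_length (tour_walk T)).

Lemma walk_hits (x y : net_node Q) w e u : is_walk x w y -> e \in w ->
  0 <= u <= len e.1 ->
  exists2 v, 0 <= v <= walk_length w & walk_point x w v = dart_point e u.
Proof.
elim: w x => // f w IH x /= /andP[fx hw]; rewrite inE walk_length_cons.
have w0 := walk_length_ge0 w; have f0 := len_gt0 f.1.
case/predU1P => [->|ew] /andP[u0]; last first.
  move=> ul; have [|v /andP[v0 vw] vE] := IH _ hw ew _; first by rewrite u0.
  exists (len f.1 + v); first by apply/andP; split; lra.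
  by rewrite ltNge lerDl v0 /= addrC addKr.
(* [walk_point] stays on a dart only strictly before its end, so the end is found as the start of
   the remaining walk. *)
rewrite le_eqVlt => /predU1P[->|ul].
  exists (len f.1); first by apply/andP; split; lra.
  by rewrite ltxx subrr (walk_point0 hw) dart_pointl.
by exists u; [apply/andP; split; lra|rewrite ul].
Qed.

Hypothesis L_gt0 : 0 < L.

(** At [v = L] the reduced parameter jumps to 0, and both sides agree because the walk is closed. *)
Lemma tour_point_walk v : 0 <= v <= L ->
  tour_point T v = walk_point (tour_start T) (tour_walk T) v.
Proof.
move=> /andP[v0]; rewrite le_eqVlt => /predU1P[->|vL]; rewrite /tour_point.
  rewrite divff ?gt_eqF // floor1 mulr1 subrr.
  by rewrite (walk_point0 (tour_closed T)) (walk_pointl (tour_closed T)).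
suff -> : Num.floor (v / L) = 0 by rewrite mulr0 subr0.
by apply/floor_def; rewrite add0r divr_ge0 ?(ltW L_gt0) //= ltr_pdivrMr // mul1r.
Qed.

Lemma tour_point_periodic v (k : int) : tour_point T (v + L * k%:~R) = tour_point T v.
Proof.
rewrite /tour_point; congr walk_point.
have -> : (v + L * k%:~R) / L = v / L + k%:~R by field; rewrite gt_eqF.
by rewrite floorDrz ?intr_int // intrKfloor intrD; ring.
Qed.

Lemma tour_hits_arc a s : a \in B -> 0 <= s <= len a ->
  exists v, tour_point T v = arc_point a s.
Proof.
move=> aB /andP[s0 sl].
have : a \in [seq e.1 | e <- tour_walk T] by rewrite (perm_mem (tour_once T)) mem_enum.
case/mapP => e ew ae.
have [|v vL vE] := walk_hits (tour_closed T) ew (u := if e.2 then s else len a - s).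
  by rewrite -ae; case: e.2; apply/andP; split; lra.
exists v; rewrite tour_point_walk // vE /dart_point -ae.
by case: e.2; rewrite // opprB addrC subrK.
Qed.

Lemma random_tour_intercepts (alpha : R) x (t : time R) : 0 < alpha -> alpha <= L ->
  (exists v, tour_point T v = x) ->
  ((alpha / L)%:E <= random_tour T [set S | intercepts alpha S (x, t)])%E.
Proof.
move=> a0 aL [v vx]; set E := [set S | _].
have mE : measurable (tour_patrol T @^-1` E).
  rewrite -[X in measurable X]setTI; apply: tour_patrol_measurable => //.
  exact: measurable_patrols (ltW a0) _.
rewrite /random_tour /mpush /pushforward /= /mscale /= /mrestr.
rewrite mulrC EFinM lee_pmul2l ?lte_fin ?invr_gt0 //.
set U := _ `&` _.
have mU : measurable U by exact: measurableI.
have t0 : 0 <= (t : {nonneg R})%:num by [].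
(* Starting at [u], the tour is at [x] at time [v + L * k - u]; the second condition places this
   time in the window. *)
have inU u (k : int) : 0 <= u < L ->
    v - (t : {nonneg R})%:num - alpha + L * k%:~R <= u <= v - (t : {nonneg R})%:num + L * k%:~R ->
    U u.
  move=> uL /andP[u1 u2]; split; last by rewrite /= in_itv.
  have s0 : 0 <= v + L * k%:~R - u by lra.
  exists (abs_time (v + L * k%:~R - u)).
    by rewrite abs_timeE //; apply/andP; split => /=; lra.
  rewrite -[LHS]/(tour_point T (u + (abs_time _)%:num)) abs_timeE //.
  by rewrite addrC subrK tour_point_periodic.
pose k := - Num.floor ((v - (t : {nonneg R})%:num) / L).
set c := v - (t : {nonneg R})%:num + L * k%:~R.
have /andP[c0 cL] : 0 <= c < L.
  rewrite /c /k mulrNz mulrN subr_ge0 mulrC -ler_pdivlMr // floor_le /=.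
  have := floorD1_gt ((v - (t : {nonneg R})%:num) / L).
  by rewrite ltr_pdivrMr // intrD mulrDl mul1r; lra.
(* The good starting points are those of [c - alpha, c] modulo [L]. *)
have [ac|ca] := leP alpha c.
  have <- : @lebesgue_measure R `]c - alpha, c[%classic = alpha%:E.
    by rewrite lebesgue_itvoo; [congr EFin; ring|lra].
  apply: le_measure; rewrite ?inE // => u /=; rewrite in_itv /= => /andP[u1 u2].
  by apply: (inU _ k); apply/andP; split; rewrite /c in ac c0 cL u1 u2 *; lra.
(* The good interval wraps around 0. Its second piece belongs to the shift [k + 1], and the pieces
   are disjoint because [alpha <= L]. *)
have <- : @lebesgue_measure R (`]0, c[%classic `|` `]L + c - alpha, L[%classic) = alpha%:E.
  rewrite measureU //=; last first.
    apply/seteqP; split => // u /= []; rewrite !in_itv /=; lra.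
  rewrite (lebesgue_itvoo c0) lebesgue_itvoo; last by lra.
  by rewrite -EFinD; congr EFin; ring.
apply: le_measure; rewrite ?inE //; first exact: measurableU.
move=> u /= []; rewrite in_itv /= => /andP[u1 u2].
  by apply: (inU _ k); apply/andP; split; rewrite /c in ca c0 cL u1 u2 *; lra.
apply: (inU _ (k + 1)); rewrite ?intrD ?mulrDr ?mulr1;
  by apply/andP; split; rewrite /c in ca c0 cL u1 u2 *; lra.
Qed.

Lemma random_tour_setT : random_tour T setT = 1%E.
Proof.
rewrite /random_tour /mpush /pushforward /= /mscale /= /mrestr preimage_setT setTI.
by rewrite lebesgue_measure_itv /= lte_fin L_gt0 oppr0 adde0 -EFinM mulVf ?gt_eqF.
Qed.

End tour.

Section complete.
Variables (n : nat) (alpha : R) (F : 'I_(2 * n - 1) -> {set net_arc Q}).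
Hypotheses (completeQ : complete_network Q (2 * n)) (factF : one_factorization F).
Hypotheses (n_gt1 : (1 < n)%N) (alpha_gt0 : 0 < alpha).
Hypothesis alpha_le : alpha <= total_length Q - delta F.
Variable T : forall i, euler_tour (~: F i)%SET.
Let L i := arcs_length (~: F i)%SET.

Lemma alpha_le_complement i : alpha <= L i.
Proof. by rewrite /L arcs_lengthC (le_trans alpha_le) // lerD2l lerN2 delta_ge. Qed.

Lemma complement_gt0 i : 0 < L i.
Proof. exact: lt_le_trans (alpha_le_complement i). Qed.

Lemma index_gt0 : (0 < 2 * n - 1)%N. Proof. by lia. Qed.

Lemma total_length_gt0 : 0 < total_length Q.
Proof.
have := complement_gt0 (Ordinal index_gt0); rewrite /L arcs_lengthC.
by have := arcs_length_ge0 (F (Ordinal index_gt0)); lra.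
Qed.

Lemma deg_gt0 : 0 < (2 * n - 2)%:R :> R.
Proof. by rewrite ltr0n; lia. Qed.

(** Every arc is missing from exactly one of the 2n - 1 complements, so their lengths add up to 2n -
    2 times the total length. *)
Lemma complete_patrol_setT : complete_patrol T setT = 1%E.
Proof.
have m0 := total_length_gt0; have d0 := deg_gt0.
rewrite /complete_patrol /= /fin_msum.
transitivity (\sum_i (L i / ((2 * n - 2)%:R * total_length Q))%:E)%E.
  apply: eq_bigr => i _.
  rewrite -[LHS]/((L i / ((2 * n - 2)%:R * total_length Q))%:E * random_tour (T i) setT)%E.
  rewrite random_tour_setT ?mule1 //.
  by rewrite walk_length_tour complement_gt0.
rewrite sumEFin -mulr_suml; congr EFin.
have -> : \sum_i L i = (2 * n - 2)%:R * total_length Q.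
  under eq_bigr do rewrite /L arcs_lengthC.
  rewrite sumrB (sum_arcs_length factF) sumr_const card_ord.
  have -> : (2 * n - 1 = (2 * n - 2).+1)%N by lia.
  by rewrite mulrSr addrK mulr_natl.
by rewrite divff // mulf_neq0 // gt_eqF.
Qed.

(** An inner point is missed only by the tour omitting the factor of its arc. A node lies on every
    tour, and then [j] is arbitrary. *)
Lemma tours_hit x : exists j, forall i, i != j -> exists v, tour_point (T i) v = x.
Proof.
have [k kF] := factor_index factF.
have TL i : 0 < walk_length (tour_walk (T i)) by rewrite walk_length_tour complement_gt0.
case: (net_pointP x) => [u|a s /andP[s0 sl]]; last first.
  exists (k a) => i ia; apply: tour_hits_arc => //; last by rewrite (ltW s0) ltW.
  by rewrite inE kF eq_sym.
exists (Ordinal index_gt0) => i _.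
have : (0 < degree (~: F i)%SET u)%N by rewrite (degreeC factF n_gt1); lia.
case/card_gt0P => a; rewrite inE => /andP[aF /orP[/eqP <-|/eqP <-]].
  rewrite -(@arc_point_src _ _ a 0) //; apply: tour_hits_arc => //.
  by rewrite lexx ltW ?len_gt0.
rewrite -(@arc_point_tgt _ _ a (len a)) //; apply: tour_hits_arc => //.
by rewrite lexx ltW ?len_gt0.
Qed.

Lemma complete_patrol_optimal :
  patroller_optimal alpha (alpha / total_length Q)%:E (complete_patrol T).
Proof.
have m0 := total_length_gt0; have d0 := deg_gt0.
split=> [|[x t]]; first exact: complete_patrol_setT.
have [j hit] := tours_hit x.
rewrite /complete_patrol /= /fin_msum (bigD1 j) //=.
(* The guaranteed contribution of each tour through [x]: the weight is proportional to the tour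
   length, which cancels. The term [j] is bounded below by 0. *)
set c := alpha / ((2 * n - 2)%:R * total_length Q).
have -> : alpha / total_length Q = \sum_(i < 2 * n - 1 | i != j) c.
  rewrite sumr_const cardC1 card_ord.
  have -> : ((2 * n - 1).-1 = 2 * n - 2)%N by lia.
  by rewrite -mulr_natl /c; field; rewrite !gt_eqF.
rewrite -sumEFin -[leLHS]add0e; apply: leeD.
  exact: measure_ge0.
apply: lee_sum => i ij.
rewrite -[leRHS]/((L i / ((2 * n - 2)%:R * total_length Q))%:E *
  random_tour (T i) [set S | intercepts alpha S (x, t)])%E.
have L0 : 0 < walk_length (tour_walk (T i)) by rewrite walk_length_tour complement_gt0.
have := @random_tour_intercepts _ (T i) L0 alpha x t alpha_gt0.
rewrite {1}walk_length_tour alpha_le_complement => /(_ isT (hit i ij)).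
set w := L i / _.
have w0 : 0 < w by rewrite divr_gt0 ?mulr_gt0 ?complement_gt0.
move=> /(@lee_wpmul2l _ w%:E) le; apply: le_trans (le _); last by rewrite lee_fin ltW.
rewrite -EFinM lee_fin walk_length_tour /w /L /c le_eqVlt; apply/orP; left; apply/eqP.
by field; rewrite !gt_eqF ?complement_gt0.
Qed.

End complete.
End patroller.

(** * The uniform attack *)

Section attacker.
Context {R : realType} (Q : network R) (alpha : R).
Hypothesis alpha_gt0 : 0 < alpha.
Variables (S : patrol Q) (t : time R).
Let visited : set (net_point Q) := [set x | intercepts alpha S (x, t)].

Lemma measurable_visited : measurable visited.
Proof.
rewrite -[X in measurable X]setTI.
exact: (pair2_measurable t) (measurable_attacks (ltW alpha_gt0) S).
Qed.

(** A ball around [y] restricted to the arc containing [y], so that each position is charged to at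
    most one arc. What reaches past a node is left to the end pieces in [visited_cover]. *)
Definition cell (y : net_point Q) (r : R) (a : net_arc Q) : set R :=
  if y is Inner b u _ then
    if b == a then `[u - r, u + r]%classic else set0
  else set0.

Definition on_arc (y : net_point Q) (a : net_arc Q) : bool :=
  if y is Inner b _ _ then b == a else false.

Lemma measurable_cell y r a : measurable (cell y r a).
Proof. by case: y => //= b u _; case: eqP => _ //; exact: measurable_itv. Qed.

Lemma lebesgue_cell y r a : 0 <= r ->
  (@lebesgue_measure R (cell y r a) = (on_arc y a)%:R%:E * (2 * r)%:E)%E.
Proof.
move=> r0; case: y => [v|b u _] /=; first by rewrite measure0 mul0e.
case: eqP => _; last by rewrite measure0 mul0e.
rewrite lebesgue_measure_itv /= lte_fin mul1e.
case: ltgtP => [_|h|h]; [|exfalso; lra|].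
  by rewrite -EFinB; congr EFin; ring.
by congr EFin; lra.
Qed.

Lemma sum_on_arc y : \sum_a (on_arc y a)%:R <= 1 :> R.
Proof.
case: y => [v|b u h] /=; first by rewrite big1.
by rewrite (bigD1 b) //= eqxx big1 ?addr0 // => a /negPf; rewrite eq_sym => ->.
Qed.

Variable N : nat.
Hypothesis N_gt0 : (0 < N)%N.
Let h : R := alpha / N%:R.
Let mid (i : nat) : {nonneg R} :=
  abs_time ((t : {nonneg R})%:num + (i%:R + 2^-1) * h).

Lemma step_gt0 : 0 < h.
Proof. by rewrite divr_gt0 ?ltr0n. Qed.

(* Cut the time window into slots of length [h]: a visited point at distance at
   least [h] from the ends of its arc lies, on that arc, within [h / 2] of the
   position at the middle of the slot. *)
Lemma visited_cover (a : net_arc Q) :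
  arc_point a @^-1` visited `&` `]0, len a[ `<=`
  (`[0, h] `|` `[len a - h, len a]) `|`
  \bigcup_(i < N.+1) cell (S (mid i)) (h / 2) a.
Proof.
have h0 := step_gt0.
move=> w /= [[s /= /andP[ts st] Sw]]; rewrite in_itv /= => /andP[w0 wl].
have [wh|hw] := leP w h; first by left; left; rewrite /= in_itv /= wh ltW.
have [lw|wl'] := leP (len a - h) w.
  by left; right; rewrite /= in_itv /= lw ltW.
right; set r := s%:num - (t : {nonneg R})%:num.
have r0 : 0 <= r by rewrite subr_ge0.
have ra : r <= alpha by rewrite lerBlDl.
have rh0 : 0 <= r / h by rewrite divr_ge0 ?(ltW h0).
have /andP[] := truncn_itv rh0; set i := Num.truncn _.
rewrite ler_pdivlMr // ltr_pdivrMr // => ir ri.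
(* The last instant of the window may give [i = N], hence [N.+1] slots. *)
exists i => /=.
  have : (i%:R : R) <= N%:R.
    rewrite -(ler_pM2r h0) (le_trans ir) // (le_trans ra) // /h mulrC divfK //.
    by rewrite gt_eqF // ltr0n.
  by rewrite ler_nat.
have t0 : 0 <= (t : {nonneg R})%:num by [].
have i0 : 0 <= i%:R :> R by [].
have m0 : 0 <= (t : {nonneg R})%:num + (i%:R + 2^-1) * h.
  by rewrite addr_ge0 // mulr_ge0 ?(ltW h0) // addr_ge0 // invr_ge0.
have dS : dist (arc_point a w) (S (mid i)) <= h / 2.
  rewrite -Sw; apply: le_trans (patrol_speed _ _ _) _.
  rewrite /mid abs_timeE // ler_norml; rewrite -[i.+1]addn1 natrD in ri.
  apply/andP; split; rewrite /r in ir ri; lra.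
have [||| u Su wu] := @dist_inner _ _ a w h (S (mid i)).
- exact: ltW.
- by lra.
- by lra.
have {wu}wu := le_trans wu dS.
have uin : 0 < u < len a by move: wu; rewrite ler_norml => /andP[? ?]; lra.
rewrite Su (arc_pointE uin) /= eqxx /= in_itv /=.
by move: wu; rewrite ler_norml => /andP[? ?]; lra.
Qed.

(** The two end pieces cost [2 * h] on each arc. The [N.+1] cells cost at most [h] each over all
    arcs together, hence [alpha + h]. *)
Lemma lambda_visited_step :
  (lambda Q visited <= (alpha + (1 + 2 * #|net_arc Q|%:R) * h)%:E)%E.
Proof.
have h0 := step_gt0.
rewrite /lambda /= /fin_msum.
have bound (a : net_arc Q) :
    (@lebesgue_measure R (arc_point a @^-1` visited `&` `]0%R, len a[%classic) <=
     (2 * h)%:E + \sum_(i < N.+1) ((on_arc (S (mid i)) a)%:R * h)%:E)%E.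
  have mV : measurable (arc_point a @^-1` visited `&` `]0, len a[).
    apply: measurableI; last exact: measurable_itv.
    rewrite -[X in measurable X]setTI.
    by apply: arc_point_measurable => //; exact: measurable_visited.
  have mC (i : nat) : measurable (cell (S (mid i)) (h / 2) a) by exact: measurable_cell.
  have mB : measurable (\bigcup_(i < N.+1) cell (S (mid i)) (h / 2) a).
    exact: bigcup_measurable.
  have mI (b c : R) : measurable `[b, c]%classic by exact: measurable_itv.
  apply: (@le_trans _ _ (@lebesgue_measure R _)).
    by apply: le_measure; last exact: visited_cover;
      rewrite inE //; do 2?apply: measurableU.
  have leU (A B : set R) : measurable A -> measurable B ->
      (@lebesgue_measure R (A `|` B) <= @lebesgue_measure R A + @lebesgue_measure R B)%E.
    by move=> mA mD; exact: (@measureU2 _ _ _ (@lebesgue_measure R) A B mA mD).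
  apply: le_trans (leU _ _ _ mB) _; first exact: measurableU.
  apply: leeD.
    apply: le_trans (leU _ _ (mI _ _) (mI _ _)) _.
    rewrite !lebesgue_measure_itv /= !lte_fin h0 ifT; last lra.
    by rewrite -!EFinB -EFinD lee_fin; lra.
  rewrite bigcup_mkord.
  have := @Boole_inequality _ _ _ (@lebesgue_measure R)
    (fun i => cell (S (mid i)) (h / 2) a) N.+1 (fun i _ => mC i).
  move=> /le_trans; apply.
  apply: lee_sum => i _.
  rewrite -[leLHS]/(@lebesgue_measure R (cell (S (mid i)) (h / 2) a)).
  rewrite lebesgue_cell; last by lra.
  by rewrite -EFinM lee_fin [2 * _]mulrC divfK.
apply: le_trans (lee_sum _ (fun a _ => bound a)) _.
rewrite big_split /= exchange_big /= sumEFin sumr_const.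
under eq_bigr do rewrite sumEFin -mulr_suml.
rewrite sumEFin -EFinD lee_fin.
have : \sum_(i < N.+1) (\sum_a (on_arc (S (mid i)) a)%:R) * h <= \sum_(i < N.+1) h.
  by apply: ler_sum => i _; rewrite ler_piMl ?(ltW h0) // sum_on_arc.
rewrite sumr_const card_ord mulrS -[h *+ N]mulr_natr {3}/h divfK ?gt_eqF ?ltr0n //.
move=> le; rewrite -mulr_natr; lra.
Qed.

End attacker.

Section uniform_attack.
Context {R : realType} (Q : network R) (alpha : R).
Hypothesis alpha_gt0 : 0 < alpha.

Lemma lambda_visited (S : patrol Q) (t : time R) :
  (lambda Q [set x | intercepts alpha S (x, t)] <= alpha%:E)%E.
Proof.
apply/lee_addgt0Pr => e e0.
(* With [k.+1] slots the error in [lambda_visited_step] is [C / k.+1], which is made smaller than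
   [e]. *)
pose C : R := (1 + 2 * #|net_arc Q|%:R) * alpha.
have C0 : 0 < C by rewrite mulr_gt0 // ltr_pwDl // mulr_ge0.
have [k] := @ltr_add_invr R 0 (e / C) ltac:(by rewrite divr_gt0).
rewrite add0r => ke; apply: le_trans (lambda_visited_step alpha_gt0 S t (ltn0Sn k)) _.
rewrite -EFinD lee_fin lerD2l mulrA -/C.
by move: ke; rewrite ltr_pdivlMr // mulrC => /ltW.
Qed.

Lemma uniform_attack_optimal t : 0 < total_length Q ->
  attacker_optimal alpha (alpha / total_length Q)%:E (uniform_attack Q t).
Proof.
move=> m0; split=> [|S].
  rewrite -[LHS]/((total_length Q)^-1%:E * lambda Q (_ @^-1` setT))%E preimage_setT.
  by rewrite lambda_setT -EFinM mulVf ?gt_eqF.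
rewrite -[leLHS]/((total_length Q)^-1%:E * lambda Q [set x | intercepts alpha S (x, t)])%E.
rewrite mulrC EFinM; apply: lee_wpmul2l; last exact: lambda_visited.
by rewrite lee_fin invr_ge0 ltW.
Qed.

End uniform_attack.

(** * Duality and the value *)

Section measure_probability.
Context d (T : measurableType d) (R : realType).
Variables (p : {measure set T -> \bar R}) (p1 : p setT = 1%E).

(** The game values range over [probability], while the strategies are plain measures; the proof of
    mass one is carried along to bridge the two. *)
Definition measure_probability of p setT = 1%E : set T -> \bar R := p.
Local Notation P := (measure_probability p1).

HB.instance Definition _ := isMeasure.Build _ _ _ P
  (measure0 p) (measure_ge0 p) (@measure_semi_sigma_additive _ _ _ p).

HB.instance Definition _ := Measure_isProbability.Build _ _ _ P p1.
End measure_probability.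

Section value.
Context {R : realType} (Q : network R) (alpha : R).
Hypothesis alpha_gt0 : 0 < alpha.

Local Open Scope ereal_scope.

Lemma lower_le_upper : lower_value Q alpha <= upper_value Q alpha.
Proof.
apply: ge_ereal_sup => _ [p _ <-]; apply: le_ereal_inf_tmp => _ [q _ <-].
set l := ereal_inf _; set u := ereal_sup _.
have mI := @measurable_intercepts R Q alpha (ltW alpha_gt0).
set I := [set r : patrol Q * attack Q | _] in mI.
have ysecE a : ysection I a = [set S | intercepts alpha S a].
  by apply/seteqP; split => S; rewrite /ysection /= inE.
have xsecE S : xsection I S = [set a | intercepts alpha S a].
  by apply/seteqP; split => a; rewrite /xsection /= inE.
have l0 : 0 <= l by apply: le_ereal_inf_tmp => _ [a _ <-]; exact: measure_ge0.
have u0 : 0 <= u.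
  apply: le_ereal_sup_tmp; exists (q [set a | intercepts alpha (point : patrol Q) a]).
    by exists (point : patrol Q).
  exact: measure_ge0.
(* As [q] and [p] have mass one, [l] and [u] become integrals of constants, to be compared pointwise
   with the sections of [I]. *)
rewrite -[l]mule1 -(@probability_setT _ _ _ q) -integral_cst //.
rewrite -[u]mule1 -(@probability_setT _ _ _ p) -integral_cst //.
apply: (@le_trans _ _ (\int[q]_a p (ysection I a))).
  apply: ge0_le_integral => //; first exact: measurable_fun_ysection.
  by move=> a _ /=; rewrite ysecE; apply: ereal_inf_lbound; exists a.
have -> : \int[q]_a p (ysection I a) = \int[p]_S q (xsection I S).
  have := indic_fubini_tonelli p q mI.
  by rewrite indic_fubini_tonelli_FE // indic_fubini_tonelli_GE // => ->.
apply: ge0_le_integral => //; first exact: measurable_fun_xsection.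
by move=> S _ /=; rewrite xsecE; apply: ereal_sup_ubound; exists S.
Qed.

Lemma value_of_optimal V (p : {measure set patrol Q -> \bar R})
    (q : {measure set attack Q -> \bar R}) :
  patroller_optimal alpha V p -> attacker_optimal alpha V q ->
  is_value Q alpha V.
Proof.
move=> [p1 Vp] [q1 qV].
have lowV : (V <= lower_value Q alpha)%E.
  apply: le_ereal_sup_tmp; eexists; first by exists (measure_probability p1).
  by apply: le_ereal_inf_tmp => _ [a _ <-]; exact: Vp.
have uppV : (upper_value Q alpha <= V)%E.
  apply: ge_ereal_inf; eexists; first by exists (measure_probability q1).
  by apply: ge_ereal_sup => _ [S _ <-]; exact: qV.
have lu := lower_le_upper.
split; apply/eqP; rewrite eq_le ?lowV ?uppV ?andbT /=.
  exact: le_trans lu uppV.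
exact: le_trans lowV lu.
Qed.

End value.

Theorem proposition15 (R : realType) (n : nat) (hn : (0 < n)%N)
    (Q : network R) (hQ : complete_network Q (2 * n))
    (F : 'I_(2 * n - 1) -> {set net_arc Q}) (hF : one_factorization F)
    (hFmin : forall F' : 'I_(2 * n - 1) -> {set net_arc Q},
       one_factorization F' -> delta F <= delta F')
    (alpha : R) (halpha0 : 0 < alpha)
    (halpha : forall (x : net_node Q) (w : seq (dart Q)),
       closed_covering_walk x w -> alpha <= walk_length w)
    (hdelta : alpha <= total_length Q - delta F) :
  let V := (alpha / total_length Q)%:E in
  [/\ is_value Q alpha V,
      forall T : (forall i, euler_tour (~: F i)%SET),
        patroller_optimal alpha V (complete_patrol T) &
      forall t : time R, attacker_optimal alpha V (uniform_attack Q t)].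
Proof.
move=> V.
(* For [n = 1] the only factor is the whole network, so [hdelta] would force [alpha <= 0]. *)
have n_gt1 : (1 < n)%N.
  rewrite ltnNge; apply/negP => n_le1.
  have n1 : n = 1%N by apply/eqP; rewrite eqn_leq n_le1 hn.
  subst n; have := sum_arcs_length hF; rewrite big_ord1 => muE.
  by have := delta_ge F ord0; move: hdelta; rewrite -muE; lra.
have patroller_opt T : patroller_optimal alpha V (@complete_patrol R Q n F T).
  exact: complete_patrol_optimal hdelta T.
have attacker_opt t : attacker_optimal alpha V (uniform_attack Q t).
  exact/uniform_attack_optimal/(total_length_gt0 n_gt1 halpha0 hdelta).
(* The value claim needs an actual family of tours, which Euler's theorem supplies. *)
have [T] := complement_tour hQ hF n_gt1.
split => //.
exact: value_of_optimal (patroller_opt T) (attacker_opt (point : time R)).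
Qed.
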